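(* Consider the relay system described in the context. For every choice of an integer threshold $e_{th}$ with $0\le e_{th}\le N-b_{\max}+1$, the following threshold-based dynamic policy is throughput-optimal, i.e. maximizes the source throughput $\lambda_S=p^{det}_S+p^a_R\,p^{det}_R$ over dynamic policies: $$\alpha^{T}_{s}=\begin{cases}1, & s\in\{(0,q_e)\mid q_e\ge e_{th}\},\\ 0, & s\in\{(0,q_e)\mid q_e<e_{th}\},\\ 0, & s\in\{(1,q_e)\mid 0\le q_e\le N\}.\end{cases}$$ Consequently, $\overline{\alpha^T_s}=\sum_{s}p_s\alpha^T_s=\alpha^T$, where $p_s$ is the long-run probability of state $s$ at the beginning of a slot under the policy $\alpha^T_s$, and $$\alpha^{T}=\frac{E(\Gamma)\,p^{det}_R}{E(\Gamma)\,p^{det}_R+K(1-p^{det}_S)}.$$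
   Context: Model. Parameters: $p^{det}_S,p^{det}_R\in(0,1)$; integers $b_{\max}\ge 1$, $K$, $N$ with $b_{\max}\le K$ and $N\ge 2K$; a random variable $\Gamma$ on $\{0,1,\dots,b_{\max}\}$ with $\gamma_m=\Pr\{\Gamma=m\}$, $\gamma_{b_{\max}}>0$, and mean $E(\Gamma)>0$. A relay R has an infinite data buffer $Q_d$ and an energy buffer $Q_e$ of size $N$. Time is slotted, each slot (the time unit) consisting of two equal subslots. At the beginning of a slot the state is $s=(q_d,q_e)$, with $q_d\in\{0,1,2,\dots\}$ the number of data packets in $Q_d$ and $q_e\in\{0,\dots,N\}$ the number of energy units in $Q_e$. With probability $\alpha_s$ node R chooses the data decoding (DD) mode, and otherwise the energy harvesting (EH) mode. First subslot: the source, which always has a packet, transmits, and the destination detects the packet with probability $p^{det}_S$. In DD mode, if the destination does not detect the packet (probability $1-p^{det}_S$), the packet is added to $Q_d$; $q_e$ does not change. In EH mode, $q_d$ does not change and $q_e$ becomes $\min(N,q_e+\Gamma)$; units in excess of $N$ are lost (blocked). Second subslot (using the values after the first subslot): if $Q_d$ contains at least one packet and $q_e\ge K$, node R is called active; it transmits the head-of-line packet (first-come first-served), $q_e$ decreases by $K$, and with probability $p^{det}_R$ the transmission succeeds and the packet leaves $Q_d$ (otherwise it stays at the head of line). If R is not active, nothing changes. All random choices (mode choices, detections, harvested amounts) are independent. The data buffer is initially empty. A dynamic policy is a family $\{\alpha_s\}$ of probabilities $\alpha_s\in[0,1]$, one for each state $s$ (only states reachable from $q_d=0$ matter; under the policy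 in the claim $q_d\le 1$ always). Long-run quantities (long-run time averages, assumed to exist). $p^a_R$ is the fraction of slots in which R is active, and the source throughput is $\lambda_S=p^{det}_S+p^a_R p^{det}_R$. *)

(* Defs.v *)
(* MathComp-Analysis; [R : realType] throughout. *)
From HB Require Import structures.
From mathcomp Require Import all_boot all_order all_algebra.
From mathcomp Require Import all_classical all_reals all_analysis.

Set Implicit Arguments.
Unset Strict Implicit.
Unset Printing Implicit Defensive.

Import Order.TTheory GRing.Theory Num.Theory.
Import numFieldNormedType.Exports.
Local Open Scope classical_set_scope.
Local Open Scope ring_scope.

(* (q_d, q_e): packets in the data buffer, units in the energy buffer. *)
Definition state (N : nat) : Type := (nat * 'I_N.+1)%type.

(* The random choices of one slot:
   (mode (true = DD), detection at the destination, harvested amount Gamma,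
    success of a transmission by R).
   All four are drawn in every slot; those that the mode or the activity of R
   makes irrelevant are ignored by the dynamics. *)
Definition slot (bmax : nat) : Type := (bool * bool * 'I_bmax.+1 * bool)%type.

Definition decodes bmax (o : slot bmax) : bool := o.1.1.1.
Definition detected bmax (o : slot bmax) : bool := o.1.1.2.
Definition harvest bmax (o : slot bmax) : 'I_bmax.+1 := o.1.2.
Definition success bmax (o : slot bmax) : bool := o.2.

(* The values of [inord] below never exceed [N], so no truncation other than
   that of [minn] takes place. *)
Definition first_subslot bmax N (s : state N) (o : slot bmax) : state N :=
  if decodes o then ((s.1 + ~~ detected o)%N, s.2)
  else (s.1, inord (minn N (s.2 + harvest o))).

Definition active (K N : nat) (s : state N) : bool :=
  (1 <= s.1)%N && (K <= s.2)%N.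

Definition second_subslot bmax (K N : nat) (s : state N) (o : slot bmax) :
    state N :=
  if active K s then ((s.1 - success o)%N, inord (s.2 - K)) else s.

(* State at the beginning of slot [t], from an empty data buffer and [e0] units
   of energy, when [o u] are the random choices of slot [u]. *)
Fixpoint state_at bmax (K N : nat) (e0 : 'I_N.+1) (o : nat -> slot bmax)
    (t : nat) : state N :=
  if t is u.+1
  then second_subslot K (first_subslot (state_at K e0 o u) (o u)) (o u)
  else (0%N, e0).

Definition active_in bmax (K N : nat) (e0 : 'I_N.+1) (o : nat -> slot bmax)
    (t : nat) : bool :=
  active K (first_subslot (state_at K e0 o t) (o t)).

Definition dynamic_policy (R : realType) (N : nat) (alpha : state N -> R) :
    Prop :=
  forall s, 0 <= alpha s <= 1.

Definition bernoulli_mass (R : realType) (p : R) (b : bool) : R :=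
  if b then p else 1 - p.

(* Probability of the choices [o] in a slot that begins in state [s]. *)
Definition slot_prob (R : realType) (bmax N : nat) (pS pR : R)
    (gamma : 'I_bmax.+1 -> R) (alpha : state N -> R)
    (s : state N) (o : slot bmax) : R :=
  bernoulli_mass (alpha s) (decodes o) * bernoulli_mass pS (detected o)
  * gamma (harvest o) * bernoulli_mass pR (success o).

(* [X t w] are the random choices of slot [t]. The law of the first [n] slots
   is a product: given the past, the mode is DD with probability [alpha] of the
   current state, and all the choices are independent. *)
Record relay_process (R : realType) (bmax K N : nat) (pS pR : R)
    (gamma : 'I_bmax.+1 -> R) (e0 : 'I_N.+1) (alpha : state N -> R)
    (d : measure_display) (T : measurableType d) (P : probability T R)
    (X : nat -> T -> slot bmax) : Prop := {
  relay_measurable : forall t o, measurable (X t @^-1` [set o]);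
  relay_law : forall (n : nat) (o : nat -> slot bmax),
    P [set w | forall t, (t < n)%N -> X t w = o t]
    = (\prod_(t < n)
         slot_prob pS pR gamma alpha (state_at K e0 o t) (o t))%:E }.

(* The fraction of the slots [0, ..., n] in which [A] occurs tends almost surely
   to [f]; the limit may depend on the sample path. *)
Definition long_run_fraction (R : realType) (d : measure_display)
    (T : measurableType d) (P : probability T R) (A : nat -> T -> bool)
    (f : T -> R) : Prop :=
  {ae P, forall w,
    (fun n : nat => (\sum_(t < n.+1) (A t w)%:R) / n.+1%:R) @ \oo --> f w}.

Definition has_throughput (R : realType) (bmax K N : nat) (pS pR : R)
    (e0 : 'I_N.+1) (d : measure_display) (T : measurableType d)
    (P : probability T R) (X : nat -> T -> slot bmax) (lambda : T -> R) :
    Prop :=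
  exists2 pa : T -> R,
    long_run_fraction P (fun t w => active_in K e0 (X ^~ w) t) pa &
    forall w, lambda w = pS + pa w * pR.

(* [X] is the process of the policy whose optimality is claimed. It has an
   almost surely constant throughput, which no process of a dynamic policy
   whose throughput exists exceeds. *)
Definition throughput_optimal (R : realType) (bmax K N : nat) (pS pR : R)
    (gamma : 'I_bmax.+1 -> R) (e0 : 'I_N.+1) (d : measure_display)
    (T : measurableType d) (P : probability T R) (X : nat -> T -> slot bmax) :
    Prop :=
  exists2 lambda : R,
    has_throughput K pS pR e0 P X (fun=> lambda) &
    forall (beta : state N -> R) (d' : measure_display)
      (T' : measurableType d') (P' : probability T' R)
      (X' : nat -> T' -> slot bmax) (lambda' : T' -> R),
      dynamic_policy beta ->
      relay_process K pS pR gamma e0 beta P' X' ->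
      has_throughput K pS pR e0 P' X' lambda' ->
      {ae P', forall w, lambda' w <= lambda}.

(* The value 0 at [q_d >= 2] is immaterial: these states are not reached. *)
Definition threshold_policy (R : realType) (N eth : nat) (s : state N) : R :=
  if (s.1 == 0%N) && (eth <= s.2)%N then 1 else 0.

Definition mean_harvest (R : realType) (bmax : nat) (gamma : 'I_bmax.+1 -> R) :
    R :=
  \sum_(m < bmax.+1) m%:R * gamma m.

(* Main.v *)
(* Let A and D count the active and the DD slots among the first n. Up to
   martingale terms, energy conservation gives K A <= E(Gamma) (n - D), and the
   fact that R cannot send more packets than it has stored gives
   pR A <= (1 - pS) D. Eliminating D bounds A / n by
   E(Gamma) (1 - pS) / (E(Gamma) pR + K (1 - pS)) for every policy. Under the
   threshold policy at most one packet is stored and no energy is ever blocked, so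
   both inequalities are equalities up to bounded terms: the bound is attained,
   and D / n tends to pR / (1 - pS) times it.
   The martingale terms are o(n) almost surely, by Chernoff bounds on sums over
   the finitely many outcomes of the first n slots and the Borel-Cantelli
   lemma. *)

Require Import Defs.
From HB Require Import structures.
From mathcomp Require Import all_boot all_order all_algebra.
From mathcomp Require Import all_classical all_reals all_analysis.
From mathcomp Require Import zify ring lra.

Set Implicit Arguments.
Unset Strict Implicit.
Unset Printing Implicit Defensive.

Import Order.TTheory GRing.Theory Num.Theory.
Import numFieldNormedType.Exports.
Local Open Scope classical_set_scope.
Local Open Scope ring_scope.

(** Inverting [1 - x <= expR (- x)] gives [expR x <= 1 / (1 - x)], and [(1 + x + 2 x^2) (1 - x) - 1
    = x^2 (1 - 2 x)] is nonnegative. *)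
Lemma expR_le1DxDsqr (R : realType) (x : R) :
  x <= 1 / 2 -> expR x <= 1 + x + 2 * x ^+ 2.
Proof.
move=> hx; have h1 := expR_ge1Dx (- x).
have x1 : 0 < 1 - x by lra.
have -> : expR x = (expR (- x))^-1 by rewrite expRN invrK.
apply: (@le_trans _ _ (1 - x)^-1).
  by rewrite lef_pV2 ?posrE ?expR_gt0.
rewrite -div1r ler_pdivrMr//.
have : 0 <= x ^+ 2 * (1 - 2 * x) by rewrite mulr_ge0 ?sqr_ge0//; lra.
nra.
Qed.

(** * Path sums, and a strong law for centred functions of a slot *)

Section relay_paths.
Context (bmax K N : nat).
Implicit Types (o : nat -> slot bmax) (s : state N).

(** Default for [nth], which turns a list into an infinite sequence; only entries within the list
    matter. *)
Let o0 : slot bmax := (true, true, ord0, true).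

Lemma eq_state_at (e0 : 'I_N.+1) o o' n : (forall t, (t < n)%N -> o t = o' t) ->
  state_at K e0 o n = state_at K e0 o' n.
Proof.
elim: n => //= n IH h; rewrite IH ?h// => t tn.
by apply: h; exact: ltnW.
Qed.

(** Built by [rcons], so that induction on [n] peels off the last slot, whose weight depends on the
    state reached by the others. *)
Fixpoint paths n : seq (seq (slot bmax)) :=
  if n is m.+1 then
    [seq rcons x v | x <- paths m, v <- index_enum (slot bmax : finType)]
  else [:: [::]].

Lemma size_paths n x : x \in paths n -> size x = n.
Proof.
elim: n x => [|n IH] x /=; first by rewrite inE => /eqP ->.
by case/allpairsP => -[y v] /= [/IH <- _ ->]; rewrite size_rcons.
Qed.

Lemma mem_paths x : x \in paths (size x).
Proof.
elim/last_ind: x => [|x v IH]; first by rewrite inE.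
by rewrite size_rcons; apply/allpairsP; exists (x, v); rewrite mem_index_enum.
Qed.

(** Summing over the last slot first costs a factor [c], since the prefix fixes the state in which
    that slot begins: the tower property in finite form. *)
Lemma sum_paths_le (R : realType) (W : state N -> slot bmax -> R) (c : R)
    (e0 : 'I_N.+1) n :
  (forall s v, 0 <= W s v) -> (forall s, \sum_v W s v <= c) ->
  \sum_(x <- paths n)
    \prod_(t < n) W (state_at K e0 (nth o0 x) t) (nth o0 x t) <= c ^+ n.
Proof.
move=> W0 Wc; have c0 : 0 <= c.
  by apply: le_trans (Wc (0%N, e0)); apply: sumr_ge0.
elim: n => [|n IH]; first by rewrite big_seq1 big_ord0 expr0.
rewrite big_allpairs_dep/= exprSr; apply: le_trans (ler_wpM2r c0 IH).
rewrite mulr_suml big_seq [leRHS]big_seq; apply: ler_sum => x xn.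
have sx := size_paths xn.
rewrite (eq_bigr (fun v => (\prod_(t < n) W (state_at K e0 (nth o0 x) t)
    (nth o0 x t)) * W (state_at K e0 (nth o0 x) n) v)); last first.
  move=> v _; rewrite big_ord_recr/=.
  have nthE t : (t < n)%N -> nth o0 (rcons x v) t = nth o0 x t.
    by move=> tn; rewrite nth_rcons sx tn.
  congr (_ * _); last first.
    rewrite nth_rcons sx ltnn eqxx; congr (W _ _); exact: eq_state_at.
  apply: eq_bigr => t _; rewrite nthE//; congr (W _ _).
  by apply: eq_state_at => u ut; apply: nthE; exact: ltn_trans ut _.
by rewrite -mulr_sumr ler_wpM2l// prodr_ge0.
Qed.

Section process.
Context (R : realType) (pS pR : R) (gamma : 'I_bmax.+1 -> R) (e0 : 'I_N.+1)
  (alpha : state N -> R) (d : measure_display) (T : measurableType d)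
  (P : probability T R) (X : nat -> T -> slot bmax)
  (HX : relay_process K pS pR gamma e0 alpha P X).

Lemma measurable_cylinder n o :
  measurable [set w | forall t, (t < n)%N -> X t w = o t].
Proof.
have -> : [set w | forall t, (t < n)%N -> X t w = o t] =
    \bigcap_(t in `I_n) (X t @^-1` [set o t]) by [].
by apply: bigcap_measurableType => t _; exact: relay_measurable HX _ _.
Qed.

(** The event is a finite union of cylinders, whose masses [relay_law] gives; subadditivity then
    bounds it. *)
Lemma prefix_event (E : (nat -> slot bmax) -> bool) n :
  (forall o o', (forall t, (t < n)%N -> o t = o' t) -> E o = E o') ->
  measurable [set w | E (X ^~ w)] /\
  (P [set w | E (X ^~ w)] <= (\sum_(x <- paths n | E (nth o0 x))
    \prod_(t < n) slot_prob pS pR gamma alpha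
      (state_at K e0 (nth o0 x) t) (nth o0 x t))%:E)%E.
Proof.
move=> Eloc.
pose C x := [set w | forall t, (t < n)%N -> X t w = nth o0 x t].
have -> : [set w | E (X ^~ w)] =
    \big[setU/set0]_(x <- paths n | E (nth o0 x)) C x.
  rewrite -bigcup_seq_cond; apply/seteqP; split => w /=.
    move=> Ew; exists (mkseq (X ^~ w) n) => /=; last first.
      by move=> t tn; rewrite nth_mkseq.
    rewrite -[X in paths X](size_mkseq (X ^~ w) n) mem_paths/=.
    by rewrite (Eloc _ (X ^~ w))// => t tn; rewrite nth_mkseq.
  by case=> x /= /andP[_ Ex] Cx; rewrite (Eloc _ (nth o0 x)).
have mC x : measurable (C x) by exact: measurable_cylinder.
split; first exact: bigsetU_measurable.
rewrite -sumEFin; elim: (paths n) => [|x s IH].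
  by rewrite !big_nil measure0.
rewrite !big_cons; case: ifP => // Ex.
apply: le_trans (measureU2 _ _ _) _ => //; first exact: bigsetU_measurable.
by rewrite -(relay_law HX n (nth o0 x)) leeD.
Qed.

(** A path whose last factor vanishes has mass zero. This makes the modes under the threshold policy
    deterministic almost surely. *)
Lemma ae_slot_prob_neq0 : {ae P, forall w t,
  slot_prob pS pR gamma alpha (state_at K e0 (X ^~ w) t) (X t w) != 0}.
Proof.
apply: ae_foralln => t.
pose E o := slot_prob pS pR gamma alpha (state_at K e0 o t) (o t) == 0.
have Eloc o o' : (forall u, (u < t.+1)%N -> o u = o' u) -> E o = E o'.
  move=> oo'; rewrite /E oo'// (@eq_state_at e0 o o')// => u ut.
  by apply: oo'; exact: ltnW.
have [mE PE] := prefix_event Eloc.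
exists [set w | E (X ^~ w)]; split => //; last first.
  by move=> w /= /negP; rewrite negbK.
apply/eqP; rewrite -measure_le0; apply: le_trans PE _.
by rewrite big1// => x /eqP Ex; rewrite big_ord_recr/= Ex mulr0.
Qed.

Hypothesis (alphaP : dynamic_policy alpha).
Hypothesis (pS01 : 0 <= pS <= 1).
Hypothesis (pR01 : 0 <= pR <= 1).
Hypothesis (gamma_ge0 : forall m, 0 <= gamma m).
Hypothesis (gamma_sum1 : \sum_(m < bmax.+1) gamma m = 1).

Lemma slot_prob_ge0 s v : 0 <= slot_prob pS pR gamma alpha s v.
Proof.
have bern p b : 0 <= p <= 1 -> 0 <= bernoulli_mass p b.
  by case: b => /=; lra.
by rewrite /slot_prob !mulr_ge0// bern.
Qed.

(** Conditional mean written out over the four choices, so that centring can be checked by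
    algebra. *)
Lemma sum_slot (s : state N) (f : slot bmax -> R) :
  \sum_v slot_prob pS pR gamma alpha s v * f v =
  \sum_m gamma m *
   (alpha s * (pS * (pR * f (true, true, m, true)
                     + (1 - pR) * f (true, true, m, false))
     + (1 - pS) * (pR * f (true, false, m, true)
                     + (1 - pR) * f (true, false, m, false)))
   + (1 - alpha s) * (pS * (pR * f (false, true, m, true)
                     + (1 - pR) * f (false, true, m, false))
     + (1 - pS) * (pR * f (false, false, m, true)
                     + (1 - pR) * f (false, false, m, false)))).
Proof.
have pairE (I J : finType) (F : I * J -> R) :
    \sum_p F p = \sum_j \sum_i F (i, j).
  by rewrite exchange_big pair_bigA; apply: eq_bigr => -[].
rewrite (pairE _ _ (fun v => _ v * f v)) big_bool/= !pairE -big_split/=.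
apply: eq_bigr => m _; rewrite !pairE.
rewrite !big_bool /= /slot_prob/=; ring.
Qed.

Lemma sum_slot_prob s : \sum_v slot_prob pS pR gamma alpha s v = 1.
Proof.
under eq_bigr do rewrite -[slot_prob _ _ _ _ _ _]mulr1.
rewrite (sum_slot s (fun=> 1)) -[RHS]gamma_sum1; apply: eq_bigr => m _; ring.
Qed.

Variables (xi : state N -> slot bmax -> R) (B : R).
Hypothesis (B1 : 1 <= B) (xiB : forall s v, `|xi s v| <= B).
Hypothesis (xi0 : forall s, \sum_v slot_prob pS pR gamma alpha s v * xi s v = 0).

(** In the second-order expansion the linear term vanishes because [xi] is centred;
    [1 + y <= expR y] restores an exponential, which multiplies along paths. *)
Lemma slot_exp_moment (l : R) s : `|l| * B <= 1 / 2 ->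
  \sum_v slot_prob pS pR gamma alpha s v * expR (l * xi s v)
  <= expR (2 * (l * B) ^+ 2).
Proof.
move=> lB; apply: le_trans (expR_ge1Dx _).
pose q := slot_prob pS pR gamma alpha s.
apply: (@le_trans _ _ (\sum_v (q v * 1 + (l * (q v * xi s v)
   + q v * (2 * (l * B) ^+ 2))))).
  apply: ler_sum => v _.
  have lx : `|l * xi s v| <= `|l| * B by rewrite normrM ler_wpM2l.
  have lx2 : (l * xi s v) ^+ 2 <= (l * B) ^+ 2.
    rewrite -ler_sqrt ?sqr_ge0// !sqrtr_sqr; apply: le_trans lx _.
    by rewrite normrM ler_wpM2l// ler_norm.
  have := @expR_le1DxDsqr _ (l * xi s v) (le_trans (ler_norm _) (le_trans lx lB)).
  have := slot_prob_ge0 s v; rewrite -/(q v) => q0 e1.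
  rewrite [leRHS](_ : _ = q v * (1 + l * xi s v + 2 * (l * B) ^+ 2)); last by ring.
  by apply: ler_wpM2l => //; lra.
rewrite !big_split/= -mulr_sumr xi0 mulr0 add0r -!mulr_suml sum_slot_prob.
by rewrite !mul1r.
Qed.

Let S o n := \sum_(t < n) xi (state_at K e0 o t) (o t).

(** Chernoff bound; the sign of [l] is free, so both tails are covered. *)
Lemma azuma_tail (l e : R) n : `|l| * B <= 1 / 2 ->
  measurable [set w | l * S (X ^~ w) n >= e * n%:R] /\
  (P [set w | (l * S (X ^~ w) n >= e * n%:R)%R]
     <= (expR (2 * (l * B) ^+ 2 - e) ^+ n)%:E)%E.
Proof.
move=> lB; pose E o := l * S o n >= e * n%:R.
have Eloc o o' : (forall u, (u < n)%N -> o u = o' u) -> E o = E o'.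
  move=> oo'; rewrite /E /S; congr (_ <= _ * _); apply: eq_bigr => t _.
  rewrite oo'// (@eq_state_at e0 o o')// => u ut.
  by apply: oo'; exact: ltn_trans ut _.
have [mE PE] := prefix_event Eloc; split => //; apply: le_trans PE _.
rewrite lee_fin.
pose W s v := slot_prob pS pR gamma alpha s v * expR (l * xi s v).
have W0 s v : 0 <= W s v by rewrite mulr_ge0 ?slot_prob_ge0 ?expR_ge0.
have := @sum_paths_le _ W _ e0 n W0 (fun s => slot_exp_moment s lB).
move=> /(ler_wpM2r (expR_ge0 (- (e * n%:R)))) h.
apply: le_trans (le_trans h _); last first.
  by rewrite -!expRM_natl -expRD ler_expR mulrBr [e * _]mulrC.
rewrite big_mkcond mulr_suml/=; apply: ler_sum => x _.
rewrite /W [X in _ <= X * _]big_split/= -mulrA -expR_sum.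
have p0 : 0 <= \prod_(t < n) slot_prob pS pR gamma alpha
      (state_at K e0 (nth o0 x) t) (nth o0 x t).
  by apply: prodr_ge0 => *; exact: slot_prob_ge0.
(* Markov's inequality path by path: on the event, [expR (l * S - e * n)] is at least 1. *)
case: ifPn => [Ex|_]; last by rewrite !mulr_ge0// expR_ge0.
rewrite -expRD -[leLHS]mulr1 ler_wpM2l//.
by rewrite -mulr_sumr -[leLHS]expR0 ler_expR subr_ge0.
Qed.

(** The tail bounds are geometric with ratio [expR (2 * (l * B) ^+ 2 - e) < 1], so Borel-Cantelli
    applies. *)
Lemma ae_tail (l e : R) : `|l| * B <= 1 / 2 -> 2 * (l * B) ^+ 2 < e ->
  {ae P, forall w, \forall n \near \oo, l * S (X ^~ w) n < e * n%:R}.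
Proof.
move=> lB le_e.
pose F n := [set w | l * S (X ^~ w) n >= e * n%:R].
have mF n : measurable (F n) by case: (azuma_tail e n lB).
exists (lim_sup_set F); split.
- apply: bigcap_measurable => // k _; apply: bigcup_measurable => j _.
  exact: mF.
- apply: lim_sup_set_cvg0 => //.
  pose q := expR (2 * (l * B) ^+ 2 - e).
  have q1 : `|q| < 1 by rewrite ger0_norm ?expR_ge0// expR_lt1 subr_lt0.
  apply: (@le_lt_trans _ _ (\sum_(n <oo) (geometric 1 q n)%:E)%E).
    apply: lee_nneseries => n _ //; rewrite /geometric/= mul1r.
    by case: (azuma_tail e n lB).
  have -> : (\sum_(n <oo) (geometric 1 q n)%:E = (limn (series (geometric 1 q)))%:E)%E.
    rewrite -EFin_lim; last exact: is_cvg_geometric_series.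
    by congr (limn _); apply/funext => n /=; rewrite sumEFin.
  exact: ltry.
- move=> w /= Fw k _ /=; apply: contrapT => nF; apply: Fw.
  exists k => // n /= kn; rewrite ltNge; apply/negP => Fn; apply: nF.
  by exists n.
Qed.

(** Both tails are controlled at each of the countably many precisions [e k], outside a single null
    set. *)
Lemma strong_law : {ae P, forall w,
  (fun n => (\sum_(t < n.+1) xi (state_at K e0 (X ^~ w) t) (X t w)) / n.+1%:R)
    @ \oo --> (0 : R)}.
Proof.
have B0 : 0 < B by exact: lt_le_trans B1.
(* With [l = e / (4 B^2)], the exponent [2 (l B)^2 - l e] is [- e^2 / (8 B^2)]. *)
pose e k : R := k.+1%:R^-1.
have e_gt0 k : 0 < e k by rewrite invr_gt0.
have e1 k : e k <= 1 by rewrite invf_le1// ler1n.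
pose l k : R := e k / (4 * B ^+ 2).
have l0 k : 0 < l k by rewrite divr_gt0// mulr_gt0// exprn_gt0.
have lBE k : l k * B = e k / (4 * B) by rewrite /l; field; rewrite gt_eqF.
have lB k : l k * B <= 1 / 2.
  rewrite lBE ler_pdivrMr ?mulr_gt0//; move: (e k) (e1 k) B1 => x *; lra.
have lBe k : 2 * (l k * B) ^+ 2 < l k * e k.
  rewrite [ltLHS](_ : _ = l k * (e k / 2)); last first.
    by rewrite expr2 {1}lBE /l; field; rewrite gt_eqF.
  by rewrite ltr_pM2l//; have := e_gt0 k; lra.
have tail k : {ae P, forall w, \forall n \near \oo,
    l k * S (X ^~ w) n < l k * e k * n%:R}.
  by apply: ae_tail => //; rewrite gtr0_norm.
have tailN k : {ae P, forall w, \forall n \near \oo,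
    - l k * S (X ^~ w) n < l k * e k * n%:R}.
  by apply: ae_tail; rewrite ?normrN ?mulNr ?sqrrN// gtr0_norm.
move/ae_foralln: tail; move/ae_foralln: tailN; apply: filterS2 => w hN h.
apply/cvgr0Pnorm_le => eps eps0.
have [k ke] : exists k, e k <= eps.
  exists (Num.truncn eps^-1); rewrite /e invf_ple ?posrE//.
  exact/ltW/truncnS_gt.
have [m _ hm] := h k; have [m' _ hm'] := hN k.
exists (maxn m m') => // n /=; rewrite geq_max => /andP[mn m'n].
have := hm n.+1 (leqW mn); have := hm' n.+1 (leqW m'n) => /=.
rewrite mulNr -mulrN -!(mulrA (l k)) !ltr_pM2l// => a b.
rewrite normrM normfV [`|n.+1%:R|]ger0_norm// ler_pdivrMr//.
apply: (@le_trans _ _ (e k * n.+1%:R)); last by rewrite ler_pM2r.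
by rewrite ler_norml; apply/andP; split; move: a b; rewrite /S; lra.
Qed.

End process.
End relay_paths.

(** * Conservation of packets and of energy *)

Section relay_balance.
Context (R : realType) (pS pR : R) (bmax K N : nat) (gamma : 'I_bmax.+1 -> R).
Implicit Types (o : nat -> slot bmax) (s : state N) (v : slot bmax).

Let mg := mean_harvest gamma.

Definition next_state s v : state N := second_subslot K (first_subslot s v) v.

Definition acts s v : bool := active K (first_subslot s v).

(** Truncated subtraction gives the excess over [N]; counting it makes the conservation of energy
    exact. *)
Definition blocked s v : nat := (~~ decodes v * (s.2 + harvest v - N))%N.

Lemma next_data s v : ((next_state s v).1 + (acts s v && success v) =
  s.1 + (decodes v && ~~ detected v))%N.
Proof.
rewrite /next_state /acts /second_subslot /first_subslot /active.
by case: (decodes v); case: (detected v); case: (success v) => /=;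
  case: ifP => /=; lia.
Qed.

Lemma next_energy s v : ((next_state s v).2 + K * acts s v + blocked s v =
  s.2 + ~~ decodes v * harvest v)%N.
Proof.
have sN : (s.2 <= N)%N by rewrite -ltnS.
have second (u : state N) : ((second_subslot K u v).2 + K * active K u = u.2)%N.
  rewrite /second_subslot; case: ifP => [/andP[_ Ku]|]; last by rewrite muln0 addn0.
  have := ltn_ord u.2; rewrite ltnS => uN; rewrite /= inordK; lia.
rewrite second /first_subslot /blocked; case: (decodes v) => //=.
by rewrite inordK ?ltnS ?geq_minl//; lia.
Qed.

(* Given the past, both noises have mean zero: a data arrival is predicted to be
   [1 - pS] in a DD slot, a success [pR] in an active slot, and the harvest
   [E(Gamma)] in an EH slot. *)
Definition data_noise s v : R :=
  ((decodes v && ~~ detected v)%:R - (1 - pS) * (decodes v)%:R)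
  - ((acts s v && success v)%:R - pR * (acts s v)%:R).

Definition energy_noise s v : R :=
  (~~ decodes v)%:R * ((harvest v)%:R - mg).

(** One-slot conservation telescopes; the data buffer starts empty, so only its final content
    remains. *)
Lemma data_balance (e0 : 'I_N.+1) o n :
  \sum_(t < n) data_noise (state_at K e0 o t) (o t) =
  (state_at K e0 o n).1%:R - (1 - pS) * (\sum_(t < n) (decodes (o t))%:R)
  + pR * (\sum_(t < n) (active_in K e0 o t)%:R).
Proof.
elim: n => [|n IH]; first by rewrite !big_ord0/=; ring.
rewrite !big_ord_recr/= IH /data_noise.
have /(congr1 (GRing.natmul (1 : R))) := next_data (state_at K e0 o n) (o n).
rewrite !natrD /next_state /acts /active_in => h.
by move/(canRL (addrK _)): h => ->; ring.
Qed.

Lemma energy_balance (e0 : 'I_N.+1) o n :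
  K%:R * (\sum_(t < n) (active_in K e0 o t)%:R) + (state_at K e0 o n).2%:R
  + \sum_(t < n) (blocked (state_at K e0 o t) (o t))%:R
  = e0%:R + \sum_(t < n) energy_noise (state_at K e0 o t) (o t)
     + mg * (n%:R - \sum_(t < n) (decodes (o t))%:R).
Proof.
elim: n => [|n IH]; first by rewrite !big_ord0/=; ring.
rewrite !big_ord_recr/= -natr1 /energy_noise.
have := next_energy (state_at K e0 o n) (o n).
move=> /(congr1 (GRing.natmul (1 : R))).
rewrite !natrD !natrM /next_state /acts /active_in => h.
have nd : (~~ decodes (o n))%:R = 1 - (decodes (o n))%:R :> R.
  by case: (decodes _); rewrite ?subrr ?subr0.
by move: IH h; rewrite /energy_noise /active_in nd; lra.
Qed.

End relay_balance.

Lemma bounded_div_cvg0 (R : realType) (u : nat -> R) (b : R) :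
  (forall n, `|u n| <= b) -> (fun n => u n / n.+1%:R) @ \oo --> (0 : R).
Proof.
move=> ub; have h c : (fun n => c * @harmonic R n) @ \oo --> (0 : R).
  by rewrite -[X in _ --> X](mulr0 c); apply: cvgM; [exact: cvg_cst|exact: cvg_harmonic].
apply: (squeeze_cvgr _ (h (- b)) (h b)); apply: nearW => n.
by rewrite mulNr -ler_norml normrM normfV [`|n.+1%:R|]ger0_norm// ler_wpM2r.
Qed.

(** * Long-run averages along one path, from the two balances *)

Section relay_averages.
Context (R : realType) (pS pR : R) (bmax K N : nat) (gamma : 'I_bmax.+1 -> R)
  (e0 : 'I_N.+1).
Hypothesis (pS01 : 0 < pS < 1) (pR01 : 0 < pR < 1).
Hypothesis (bmax_ge1 : (1 <= bmax)%N) (bmax_leK : (bmax <= K)%N).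
Hypothesis (gamma_ge0 : forall m, 0 <= gamma m)
    (gamma_sum1 : \sum_(m < bmax.+1) gamma m = 1)
    (gamma_mean : 0 < mean_harvest gamma).
Implicit Types (o : nat -> slot bmax) (s : state N) (v : slot bmax).

Let mg := mean_harvest gamma.
Let C := mg * pR + K%:R * (1 - pS).

(** Activity is settled before [success] is read, and in an EH slot it ignores [detected] as well,
    so arrivals and successes are each centred by their prediction. *)
Lemma mean_data_noise (alpha : state N -> R) s :
  \sum_v slot_prob pS pR gamma alpha s v * data_noise pS pR K s v = 0.
Proof.
rewrite sum_slot big1// => m _.
have Es a b : acts K s (a, b, m, false) = acts K s (a, b, m, true) by [].
have Ed : acts K s (false, false, m, true) = acts K s (false, true, m, true) by [].
rewrite /data_noise !Es Ed /= !andbT !andbF /=; ring.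
Qed.

Lemma mean_energy_noise (alpha : state N -> R) s :
  \sum_v slot_prob pS pR gamma alpha s v * energy_noise gamma s v = 0.
Proof.
rewrite sum_slot /energy_noise /=.
transitivity (\sum_(m < bmax.+1) ((1 - alpha s) * (m%:R * gamma m)
    - (1 - alpha s) * mg * gamma m)).
  by apply: eq_bigr => m _; rewrite /harvest /= /mg; ring.
by rewrite sumrB -!mulr_sumr gamma_sum1 -/(mean_harvest gamma) mulr1 subrr.
Qed.

Lemma data_noise_bound s v : `|data_noise pS pR K s v| <= 2.
Proof.
rewrite ler_norml /data_noise; have /andP[? ?] := pS01; have /andP[? ?] := pR01.
case: (decodes v); case: (detected v); case: (acts K s v); case: (success v) => /=;
  by apply/andP; split; lra.
Qed.

Lemma energy_noise_bound s v : `|energy_noise gamma s v| <= bmax%:R + mg.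
Proof.
have h : (harvest v)%:R <= bmax%:R :> R by rewrite ler_nat -ltnS.
have h0 : 0 <= (harvest v)%:R :> R by [].
rewrite /energy_noise -/mg; move: h h0 gamma_mean; rewrite -/mg.
move: mg (_%:R) => m x ? ? ?.
by rewrite ler_norml; case: (decodes v) => /=; lra.
Qed.

(** Coincides with the fraction in [long_run_fraction]; the denominator never vanishes. *)
Definition avg (u : nat -> R) n := (\sum_(t < n.+1) u t) / n.+1%:R.

(** The whole probabilistic input to the limits of activity and decoding, which hold on each single
    path with this property. *)
Definition noiseless o :=
  avg (fun t => data_noise pS pR K (state_at K e0 o t) (o t)) @ \oo --> (0 : R)
  /\ avg (fun t => energy_noise gamma (state_at K e0 o t) (o t)) @ \oo --> (0 : R).

Lemma ae_noiseless (alpha : state N -> R) (d : measure_display)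
    (T : measurableType d) (P : probability T R) (X : nat -> T -> slot bmax) :
  dynamic_policy alpha -> relay_process K pS pR gamma e0 alpha P X ->
  {ae P, forall w, noiseless (X ^~ w)}.
Proof.
move=> aP HX.
have pS01' : 0 <= pS <= 1 by case/andP: pS01 => /ltW -> /ltW ->.
have pR01' : 0 <= pR <= 1 by case/andP: pR01 => /ltW -> /ltW ->.
(* [strong_law] asks for a bound on the noise that is at least 1. *)
have b1 : 1 <= bmax%:R + mg.
  by rewrite -[leLHS]addr0 lerD ?ler1n// ltW.
apply: filterS2 (strong_law HX aP pS01' pR01' gamma_ge0 gamma_sum1
   (ler1n _ 2) data_noise_bound (@mean_data_noise _))
  (strong_law HX aP pS01' pR01' gamma_ge0 gamma_sum1
   b1 energy_noise_bound (@mean_energy_noise _)) => w; by split.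
Qed.

Definition noise o n : R :=
  (1 - pS) * avg (fun t => energy_noise gamma (state_at K e0 o t) (o t)) n
  + mg * avg (fun t => data_noise pS pR K (state_at K e0 o t) (o t)) n.

(** Bounded below for every policy, which gives the upper bound on activity; bounded above too when
    nothing is blocked and [q_d <= 1], which gives attainment. *)
Definition boundary o n : R :=
  (1 - pS) * ((state_at K e0 o n).2%:R - e0%:R
              + \sum_(t < n) (blocked (state_at K e0 o t) (o t))%:R)
  + mg * (state_at K e0 o n).1%:R.

(* The coefficients cancel the fraction of DD slots from the two balances. *)
Lemma activity_balance o n :
  C * avg (fun t => (active_in K e0 o t)%:R) n =
  mg * (1 - pS) + noise o n - boundary o n.+1 / n.+1%:R.
Proof.
have := energy_balance K gamma e0 o n.+1.
have := data_balance pS pR K e0 o n.+1.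
rewrite /noise /boundary /avg /C -/mg => hd he.
have n0 : n.+1%:R != 0 :> R by rewrite pnatr_eq0.
rewrite !mulrA -!mulrDl -[X in X + _ - _](mulfK n0) -mulrDl -mulrBl.
congr (_ / _).
rewrite hd; have := congr1 ( *%R (1 - pS)) he; rewrite -/mg; lra.
Qed.

Lemma rate_gt0 : 0 < C.
Proof.
have /andP[_ pS1] := pS01; have /andP[pR0 _] := pR01.
by rewrite addr_gt0 ?mulr_gt0 ?subr_gt0 ?ltr0n// (leq_trans bmax_ge1).
Qed.

Definition max_activity : R := mg * (1 - pS) / C.

Lemma noise_cvg0 o : noiseless o -> noise o @ \oo --> (0 : R).
Proof.
case=> hd he; rewrite -[X in _ --> X](addr0 0).
by apply: cvgD; [rewrite -(mulr0 (1 - pS))|rewrite -(mulr0 mg)];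
  apply: cvgM => //; exact: cvg_cst.
Qed.

(** Stored packets, stored energy and blocked units can only lower the activity; what remains of
    [boundary] is the constant due to [e0], negligible on average. *)
Lemma activity_le o (f : R) : noiseless o ->
  avg (fun t => (active_in K e0 o t)%:R) @ \oo --> f -> f <= max_activity.
Proof.
move=> no fE; rewrite /max_activity ler_pdivlMr ?rate_gt0// mulrC.
have lhs : (fun n => C * avg (fun t => (active_in K e0 o t)%:R) n) @ \oo --> C * f.
  by apply: cvgM => //; exact: cvg_cst.
pose b := (1 - pS) * e0%:R.
have rhs : (fun n => mg * (1 - pS) + noise o n + b / n.+1%:R) @ \oo -->
    mg * (1 - pS) + 0 + 0.
  apply: cvgD; last exact: (@bounded_div_cvg0 _ (fun=> b) `|b|).
  by apply: cvgD; [exact: cvg_cst|exact: noise_cvg0].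
rewrite !addr0 in rhs; apply: ler_cvg_to lhs rhs _; apply: nearW => n.
rewrite activity_balance lerD2l -mulNr ler_wpM2r ?invr_ge0// /boundary /b.
have pS1 : 0 <= 1 - pS by case/andP: pS01; lra.
set B := \sum_(t < n.+1) _.
have B0 : 0 <= B by apply: sumr_ge0.
have h1 : 0 <= (1 - pS) * ((state_at K e0 o n.+1).2%:R + B).
  by rewrite mulr_ge0// addr_ge0.
have h2 : 0 <= mg * (state_at K e0 o n.+1).1%:R by rewrite mulr_ge0// ltW.
lra.
Qed.

Section no_loss.
Variable o : nat -> slot bmax.
Hypothesis (no : noiseless o).
Hypothesis (data_le1 : forall t, ((state_at K e0 o t).1 <= 1)%N).
Hypothesis (no_blocked : forall t, blocked (state_at K e0 o t) (o t) = 0%N).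

Lemma activity_cvg :
  avg (fun t => (active_in K e0 o t)%:R) @ \oo --> max_activity.
Proof.
have -> : avg (fun t => (active_in K e0 o t)%:R) =
    fun n => C^-1 * (mg * (1 - pS) + noise o n - boundary o n.+1 / n.+1%:R).
  apply/funext => n; rewrite -activity_balance mulKf//.
  by rewrite gt_eqF ?rate_gt0.
rewrite /max_activity [X in _ --> X]mulrC; apply: cvgM; first exact: cvg_cst.
rewrite -[X in _ --> X]subr0 -[X in _ --> X - _]addr0.
apply: cvgB; first by apply: cvgD; [exact: cvg_cst|exact: noise_cvg0].
(* The energy level differs from [e0] by at most [N], and at most one packet is stored. *)
apply: (@bounded_div_cvg0 _ _ ((1 - pS) * N%:R + mg)) => n.
have pS1 : 0 <= 1 - pS by case/andP: pS01; lra.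
rewrite /boundary big1 ?addr0; last by move=> t _; rewrite no_blocked.
apply: le_trans (ler_normD _ _) _; rewrite !normrM.
rewrite (ger0_norm pS1) (gtr0_norm gamma_mean) lerD//.
  rewrite ler_wpM2l// ler_norml.
  have eN (e : 'I_N.+1) : 0 <= (e%:R : R) <= N%:R by rewrite ler0n ler_nat/= -ltnS.
  have := eN (state_at K e0 o n.+1).2; have := eN e0.
  by move=> /andP[? ?] /andP[? ?]; apply/andP; split; lra.
rewrite -[leRHS]mulr1 ler_wpM2l ?(ltW gamma_mean)// ger0_norm//.
by rewrite lern1.
Qed.

(** The data balance, solved for the DD count, reduces this limit to that of the activity. *)
Lemma decoding_cvg :
  avg (fun t => (decodes (o t))%:R) @ \oo --> mg * pR / C.
Proof.
have pS1 : 0 < 1 - pS by case/andP: pS01; lra.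
have C0 := rate_gt0.
have -> : avg (fun t => (decodes (o t))%:R) = fun n => (1 - pS)^-1 *
    (pR * avg (fun t => (active_in K e0 o t)%:R) n
     - avg (fun t => data_noise pS pR K (state_at K e0 o t) (o t)) n
     + (state_at K e0 o n.+1).1%:R / n.+1%:R).
  apply/funext => n; rewrite /avg data_balance; field.
  by rewrite nat1r pnatr_eq0/= gt_eqF.
have -> : mg * pR / C = (1 - pS)^-1 * (pR * max_activity - 0 + 0).
  by rewrite /max_activity; field; rewrite !gt_eqF.
apply: cvgM; first exact: cvg_cst.
apply: cvgD; last first.
  apply: (@bounded_div_cvg0 _ (fun n => (state_at K e0 o n.+1).1%:R) 1) => n.
  by rewrite ger0_norm// lern1.
apply: cvgB; last by case: no.
by apply: cvgM; [exact: cvg_cst|exact: activity_cvg].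
Qed.

End no_loss.
End relay_averages.

(** * Paths of the threshold policy *)

Lemma threshold_policy_dynamic (R : realType) (N eth : nat) :
  dynamic_policy (threshold_policy R (N := N) eth).
Proof.
by move=> s; rewrite /threshold_policy; case: ifP => _; rewrite ?lexx ?ler01.
Qed.

Lemma threshold_decodes (R : realType) (pS pR : R) (bmax N eth : nat)
    (gamma : 'I_bmax.+1 -> R) (s : state N) (v : slot bmax) :
  slot_prob pS pR gamma (threshold_policy R eth) s v != 0 ->
  decodes v = (s.1 == 0%N) && (eth <= s.2)%N.
Proof.
rewrite /slot_prob /threshold_policy /bernoulli_mass.
by case: (decodes v); case: ifP; rewrite ?subrr ?mul0r ?eqxx.
Qed.

Section threshold_path.
Context (bmax K N eth : nat) (e0 : 'I_N.+1) (o : nat -> slot bmax).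
Hypothesis (bmax_ge1 : (1 <= bmax)%N) (bmax_leK : (bmax <= K)%N)
  (N_ge2K : (2 * K <= N)%N).
Hypothesis decodesE : forall t, decodes (o t) =
  ((state_at K e0 o t).1 == 0%N) && (eth <= (state_at K e0 o t).2)%N.

Let st t := state_at K e0 o t.

(* A slot ends with [q_d = 1] either after a failed transmission, which has cost
   [K] units, or with fewer than [K] units; [2 K <= N] then leaves room for a
   harvest. *)
Lemma threshold_invariant t :
  ((st t).1 <= 1)%N /\ ((st t).1 = 1%N -> ((st t).2 + bmax <= N)%N).
Proof.
elim: t => [|t [IH1 IH2]]; first by split.
have := next_data K (st t) (o t); have := next_energy K (st t) (o t).
have -> : next_state K (st t) (o t) = st t.+1 by [].
have := decodesE t; rewrite -/(st t).
have h : (harvest (o t) <= bmax)%N by rewrite -ltnS.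
(* An idle slot that leaves a packet behind must have lacked the [K] units. *)
have q1 : ~~ acts K (st t) (o t) -> (st t.+1).1 = 1%N -> ((st t.+1).2 < K)%N.
  rewrite /st/= /acts /second_subslot => /negbTE a; rewrite a => q.
  by move: a; rewrite /active q /=; case: ltnP.
have := ltn_ord (st t).2.
rewrite /blocked; case: (decodes (o t)) => /=.
  (* In a DD slot the rule forces [q_d = 0], so at most one packet is stored. *)
  move=> ? /esym /andP[/eqP q0 _].
  by case: (acts K (st t) (o t)) q1; case: (success (o t));
    case: (detected (o t)) => /=; lia.
move=> ? _.
by case: (acts K (st t) (o t)) q1; case: (success (o t));
    case: (detected (o t)) => /=; lia.
Qed.

Hypothesis eth_le : (eth <= N - bmax + 1)%N.

(** An EH slot begins either with [q_d = 1], where the invariant leaves room for [bmax] units, or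
    below the threshold, where [q_e <= eth - 1 <= N - bmax]. *)
Lemma threshold_no_blocked t : blocked (st t) (o t) = 0%N.
Proof.
have h : (harvest (o t) <= bmax)%N by rewrite -ltnS.
have [q1 q2] := threshold_invariant t.
rewrite /blocked decodesE -/(st t).
case: (ltngtP (st t).1 1) q1 q2 => //= q _ q2.
  case: (leqP eth _) => /=; first by rewrite andbT; move: q; case: (st t).1.
  by rewrite andbF; lia.
by rewrite q; have := q2 q; lia.
Qed.

End threshold_path.

Theorem proposition2 (R : realType) (pS pR : R) (bmax K N : nat)
    (gamma : 'I_bmax.+1 -> R) (e0 : 'I_N.+1) (eth : nat)
    (d : measure_display) (T : measurableType d) (P : probability T R)
    (X : nat -> T -> slot bmax)
    (pS01 : 0 < pS < 1) (pR01 : 0 < pR < 1)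
    (bmax_ge1 : (1 <= bmax)%N) (bmax_leK : (bmax <= K)%N)
    (N_ge2K : (2 * K <= N)%N)
    (gamma_ge0 : forall m, 0 <= gamma m)
    (gamma_sum1 : \sum_(m < bmax.+1) gamma m = 1)
    (gamma_max : 0 < gamma ord_max)
    (gamma_mean : 0 < mean_harvest gamma)
    (eth_le : (eth <= N - bmax + 1)%N)
    (HX : relay_process K pS pR gamma e0 (threshold_policy R (N := N) eth) P X) :
  (dynamic_policy (threshold_policy R (N := N) eth) /\
   throughput_optimal K pS pR gamma e0 P X) /\
  (forall p : state N -> T -> R,
    (forall s, long_run_fraction P (fun t w => state_at K e0 (X ^~ w) t == s)
                 (p s)) ->
    {ae P, forall w,
      series (fun qd : nat => \sum_(qe < N.+1)
                p (qd, qe) w * threshold_policy R eth (qd, qe)) @ \oo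
      --> mean_harvest gamma * pR / (mean_harvest gamma * pR + K%:R * (1 - pS))}).
Proof.
have thrP := @threshold_policy_dynamic R N eth.
(* Off a null set the argument is deterministic: the noise averages out and the mode follows the
   rule. *)
have ae_path : {ae P, forall w, noiseless pS pR K gamma e0 (X ^~ w) /\
    forall t, decodes (X t w) = ((state_at K e0 (X ^~ w) t).1 == 0%N) &&
      (eth <= (state_at K e0 (X ^~ w) t).2)%N}.
  apply: filterS2 (ae_noiseless pS01 pR01 bmax_ge1 gamma_ge0 gamma_sum1
    gamma_mean thrP HX) (ae_slot_prob_neq0 HX) => w nw sw; split => // t.
  exact: threshold_decodes (sw t).
split; first split => //.
- exists (pS + max_activity pS pR K gamma * pR).
    exists (fun=> max_activity pS pR K gamma) => //.
    apply: filterS ae_path => w [nw dw].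
    apply: (activity_cvg pS01 pR01 bmax_ge1 bmax_leK gamma_mean nw) => t.
      by case: (threshold_invariant bmax_ge1 bmax_leK N_ge2K dw t).
    exact: (threshold_no_blocked bmax_ge1 bmax_leK N_ge2K dw eth_le).
  move=> beta d' T' P' X' lambda' betaP HX' [pa hpa lE].
  apply: filterS2 hpa (ae_noiseless pS01 pR01 bmax_ge1 gamma_ge0 gamma_sum1
    gamma_mean betaP HX') => w paw nw.
  rewrite lE lerD2l ler_wpM2r//; first by case/andP: pR01 => /ltW.
  exact: (activity_le pS01 pR01 bmax_ge1 bmax_leK gamma_mean nw paw).
- move=> p hp.
  (* Each state has its own null set; indexing by [nat] through [inord] gives a countable union.
     Only [q_d = 0] carries weight. *)
  have ae_p : {ae P, forall w (i : nat),
      avg (fun t => (state_at K e0 (X ^~ w) t == (0%N, inord i))%:R) @ \oo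
      --> p (0%N, inord i) w}.
    by apply: ae_foralln => i; exact: hp.
  apply: filterS2 ae_path ae_p => w [nw dw] pw.
  set thr := threshold_policy R eth.
  set a := mean_harvest gamma * pR / _.
  have sumE : \sum_(qe < N.+1) p (0%N, qe) w * thr (0%N, qe) = a.
    have dec : avg (fun t => (decodes (X t w))%:R) @ \oo --> a.
      apply: (decoding_cvg pS01 pR01 bmax_ge1 bmax_leK gamma_mean nw) => t.
        by case: (threshold_invariant bmax_ge1 bmax_leK N_ge2K dw t).
      exact: (threshold_no_blocked bmax_ge1 bmax_leK N_ge2K dw eth_le).
    (* The mode is a function of the state, so the DD fraction is also a finite weighted sum of
       state fractions; its two limits must agree. *)
    apply: (cvg_unique _ _ dec) => //.
    have -> : avg (fun t => (decodes (X t w))%:R) = fun n =>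
      \sum_(qe < N.+1)
        avg (fun t => (state_at K e0 (X ^~ w) t == (0%N, qe))%:R) n * thr (0%N, qe).
      apply/funext => n; rewrite /avg.
      under [RHS]eq_bigr do rewrite mulrAC mulr_suml.
      rewrite -mulr_suml exchange_big/=; congr (_ / _).
      apply: eq_bigr => t _; rewrite dw; case: (state_at _ _ _ _) => q e /=.
      rewrite (bigD1 e)//= big1 => [|i ie].
        by rewrite addr0 xpair_eqE eqxx andbT /thr /threshold_policy/=;
          case: eqP; case: leqP; rewrite ?mulr0 ?mulr1 ?mul0r.
      by rewrite xpair_eqE [e == i]eq_sym (negbTE ie) andbF mul0r.
    apply: (cvg_big (op := +%R)); first exact: add_continuous.
    move=> i _; apply: cvgM; last exact: cvg_cst.
    by have := pw i; rewrite inord_val.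
  (* The terms with [qd >= 1] vanish, so the partial sums are constant from index 1 on. *)
  apply: cvg_near_cst; exists 1%N => // n /= n1.
  rewrite seriesEnat/= big_ltn// sumE big_nat [X in _ + X]big1 ?addr0// => i /andP[i0 _].
  rewrite big1// => qe _; rewrite /thr /threshold_policy/=.
  by rewrite gtn_eqF// mulr0.
Qed.
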